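(* Let $C$ be a commutative ring, $\lambda\in C$, and let $(R,P)$ be a Baxter $C$-algebra of weight $\lambda$. Then for every integer $n\ge1$, $$P(1)^n=\sum_{k=1}^n k!\,S(n,k)\,\lambda^{n-k}P^k(1)\qquad\text{and}\qquad n!\,P^n(1)=\sum_{k=1}^n s(n,k)\,\lambda^{n-k}P(1)^k,$$ where $s(n,k)$ and $S(n,k)$ are the Stirling numbers of the first and second kind.
   Context: Rings and algebras are associative with identity $1$. A Baxter $C$-algebra of weight $\lambda\in C$ is a pair $(R,P)$ where $R$ is a $C$-algebra and $P:R\to R$ is a $C$-linear map with $P(x)P(y)=P(xP(y))+P(P(x)y)+\lambda P(xy)$ for all $x,y\in R$. $P^k$ denotes the $k$-fold composition of $P$, so $P^k(1)$ is $P$ applied $k$ times to $1$, while $P(1)^k$ is the $k$-th power of $P(1)$ in $R$; $\lambda^0=1$. With $(t)_n=t(t-1)\cdots(t-n+1)$ and $(t)_0=1$, the (signed) Stirling numbers of the first kind $s(n,k)$ and the Stirling numbers of the second kind $S(n,k)$ are defined by $(t)_n=\sum_{k=0}^n s(n,k)t^k$ and $t^n=\sum_{k=0}^n S(n,k)(t)_k$ in $\mathbb{Q}[t]$; they are integers. *)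

(* Defs.v *)
From HB Require Import structures.
From mathcomp Require Import all_boot all_order all_algebra.
Set Implicit Arguments.
Unset Strict Implicit.
Unset Printing Implicit Defensive.
Import GRing.Theory.
Local Open Scope ring_scope.

(* The library's [algType] requires 1 != 0 in the algebra. Associative unital *)
(* algebras over a commutative ring need not satisfy this, so we use a        *)
(* variant of [algType] over [pzRingType] that allows the zero algebra. It is *)
(* not an HB structure because HB would demand that [lSemiAlgType] inherit    *)
(* from the join of [pzRingType] and [lmodType C].                            *)
Record pzAlgType (C : comPzRingType) := PzAlgType {
  pzalg_ring : pzRingType;
  pzalg_scale : C -> pzalg_ring -> pzalg_ring;
  pzalg_scaleA : forall a b x,
    pzalg_scale a (pzalg_scale b x) = pzalg_scale (a * b) x;
  pzalg_scale1 : left_id 1 pzalg_scale;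
  pzalg_scaleDr : right_distributive pzalg_scale +%R;
  pzalg_scaleDl : forall x, {morph pzalg_scale^~ x : a b / a + b};
  pzalg_scaleAl : forall a x y,
    pzalg_scale a (x * y) = pzalg_scale a x * y;
  pzalg_scaleAr : forall a x y,
    pzalg_scale a (x * y) = x * pzalg_scale a y
}.

(* This constant is the key of the ring and module instances below. *)
Definition pzalg_sort (C : comPzRingType) (A : pzAlgType C) : Type :=
  pzalg_ring A.
Coercion pzalg_sort : pzAlgType >-> Sortclass.

HB.instance Definition _ (C : comPzRingType) (A : pzAlgType C) :=
  GRing.PzRing.copy (pzalg_sort A) (pzalg_ring A).
HB.instance Definition _ (C : comPzRingType) (A : pzAlgType C) :=
  GRing.Zmodule_isLmodule.Build C (pzalg_sort A) (@pzalg_scaleA C A)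
    (@pzalg_scale1 C A) (@pzalg_scaleDr C A) (@pzalg_scaleDl C A).

Lemma pzscalerAl (C : comPzRingType) (A : pzAlgType C) (a : C) (x y : A) :
  a *: (x * y) = (a *: x) * y.
Proof. exact: (@pzalg_scaleAl C A). Qed.

Lemma pzscalerAr (C : comPzRingType) (A : pzAlgType C) (a : C) (x y : A) :
  a *: (x * y) = x * (a *: y).
Proof. exact: (@pzalg_scaleAr C A). Qed.

Definition pzAlg_of_algType (C : comPzRingType) (A : algType C) : pzAlgType C :=
  @PzAlgType C A ( *:%R) (@scalerA C A) (@scale1r C A) (@scalerDr C A)
    (@scalerDl C A) (@scalerAl C A) (@scalerAr C A).

Definition baxter (C : comPzRingType) (R : pzAlgType C) (lambda : C)
    (P : {linear R -> R}) : Prop :=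
  forall x y : R,
    P x * P y = P (x * P y) + P (P x * y) + lambda *: P (x * y).

(* (t)_n in Q[t] *)
Definition ffact_poly (n : nat) : {poly rat} := \prod_(i < n) ('X - i%:R%:P).

Lemma monic_int_span (b : nat -> {poly int}) :
    (forall n, b n \is monic) -> (forall n, size (b n) = n.+1) ->
  forall n (p : {poly int}), (size p <= n)%N ->
  exists a : n.-tuple int, p = \sum_(k < n) a`_k *: b k.
Proof.
move=> monb szb; elim=> [|n IHn] p.
  by rewrite leqn0 size_poly_eq0 => /eqP->; exists [tuple]; rewrite big_ord0.
move=> szp; have [|a Da] := IHn (p - p`_n *: b n).
  apply/leq_sizeP => j; rewrite leq_eqVlt coefB coefZ => /predU1P[<-|ltnj].
    by have /monicP := monb n; rewrite /lead_coef szb /= => ->; rewrite mulr1 subrr.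
  have szbj : (size (b n) <= j)%N by rewrite szb.
  by rewrite (nth_default _ szbj) nth_default ?mulr0 ?subr0 ?(leq_trans szp).
exists [tuple of rcons a p`_n]; rewrite big_ord_recr /= nth_rcons size_tuple.
rewrite ltnn eqxx -[LHS](subrK (p`_n *: b n)) Da; congr (_ + _).
by apply: eq_bigr => i _; rewrite nth_rcons size_tuple ltn_ord.
Qed.

Lemma monic_rat_span (b : nat -> {poly int}) (B : nat -> {poly rat}) :
    (forall n, b n \is monic) -> (forall n, size (b n) = n.+1) ->
    (forall n, map_poly intr (b n) = B n) ->
  forall n (p : {poly int}), (size p <= n)%N ->
  exists a : n.-tuple int,
    map_poly intr p == \sum_(k < n) (a`_k)%:~R *: B k.
Proof.
move=> monb szb DB n p /(monic_int_span monb szb)[a ->]; exists a.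
by rewrite rmorph_sum; apply/eqP/eq_bigr => i _; rewrite /= map_polyZ DB.
Qed.

Lemma poly_basis_uniq (B : nat -> {poly rat}) (n : nat) (a c : nat -> int) :
    (forall n, size (B n) = n.+1) ->
    \sum_(k < n) (a k)%:~R *: B k = \sum_(k < n) (c k)%:~R *: B k ->
  forall k, (k < n)%N -> a k = c k.
Proof.
move=> szB; elim: n => // n IHn; rewrite !big_ord_recr /= => eq_ac.
have small (f : nat -> int) : (\sum_(k < n) (f k)%:~R *: B k)`_n = 0.
  rewrite coef_sum big1 // => i _; rewrite coefZ nth_default ?mulr0 //.
  by rewrite szB.
have Bn0 : (B n)`_n != 0.
  by have := lead_coef_eq0 (B n); rewrite /lead_coef szB /= -size_poly_eq0 szB => ->.
have eq_n : a n = c n.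
  have /(congr1 (fun p : {poly rat} => p`_n)) := eq_ac.
  by rewrite !coefD !small !coefZ !add0r => /(mulIf Bn0)/intr_inj.
move: eq_ac; rewrite eq_n => /addIr/IHn IH k.
by rewrite ltnS leq_eqVlt => /predU1P[->//|/IH].
Qed.

Local Definition ffact_polyZ n : {poly int} := \prod_(i < n) ('X - i%:R%:P).

Local Lemma map_ffact_polyZ n : map_poly intr (ffact_polyZ n) = ffact_poly n.
Proof.
rewrite rmorph_prod; apply: eq_bigr => i _.
by rewrite rmorphB /= map_polyX map_polyC /= rmorph_nat.
Qed.

Local Lemma monic_ffact_polyZ n : ffact_polyZ n \is monic.
Proof. by apply: monic_prod => i _; apply: monicXsubC. Qed.

Local Lemma size_ffact_polyZ n : size (ffact_polyZ n) = n.+1.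
Proof. by rewrite size_prod_XsubC /index_enum -enumT size_enum_ord. Qed.

Lemma size_ffact_poly n : size (ffact_poly n) = n.+1.
Proof. by rewrite size_prod_XsubC /index_enum -enumT size_enum_ord. Qed.

Lemma stirling1_ex n : exists a : n.+1.-tuple int,
  ffact_poly n == \sum_(k < n.+1) (a`_k)%:~R *: 'X^k.
Proof.
rewrite -map_ffact_polyZ.
apply: (@monic_rat_span (fun k => 'X^k)) => [k|k|k|].
- exact: monicXn.
- exact: size_polyXn.
- by rewrite map_polyXn.
- by rewrite size_ffact_polyZ.
Qed.

Lemma stirling2_ex n : exists a : n.+1.-tuple int,
  'X^n == \sum_(k < n.+1) (a`_k)%:~R *: ffact_poly k.
Proof.
have -> : 'X^n = map_poly intr 'X^n :> {poly rat} by rewrite map_polyXn.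
by apply: (monic_rat_span monic_ffact_polyZ size_ffact_polyZ map_ffact_polyZ);
  rewrite size_polyXn.
Qed.

(* s(n, k) and S(n, k), extended by 0 to k > n; see [stirling1P],             *)
(* [stirling2P] and the uniqueness lemmas that follow them.                   *)
Definition stirling1 (n k : nat) : int := (xchoose (stirling1_ex n))`_k.
Definition stirling2 (n k : nat) : int := (xchoose (stirling2_ex n))`_k.

Lemma stirling1P n :
  ffact_poly n = \sum_(k < n.+1) (stirling1 n k)%:~R *: 'X^k.
Proof. exact/eqP/(xchooseP (stirling1_ex n)). Qed.

Lemma stirling2P n :
  'X^n = \sum_(k < n.+1) (stirling2 n k)%:~R *: ffact_poly k.
Proof. exact/eqP/(xchooseP (stirling2_ex n)). Qed.

Lemma stirling1_uniq n (a : nat -> int) :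
    ffact_poly n = \sum_(k < n.+1) (a k)%:~R *: 'X^k ->
  forall k, (k <= n)%N -> a k = stirling1 n k.
Proof.
rewrite stirling1P => /esym; apply: (@poly_basis_uniq (fun k => 'X^k)) => k.
exact: size_polyXn.
Qed.

Lemma stirling2_uniq n (a : nat -> int) :
    'X^n = \sum_(k < n.+1) (a k)%:~R *: ffact_poly k ->
  forall k, (k <= n)%N -> a k = stirling2 n k.
Proof.
rewrite stirling2P => /esym.
exact: (poly_basis_uniq size_ffact_poly).
Qed.

(* Main.v *)
Require Import Defs.
From mathcomp Require Import all_boot all_order all_algebra.
From mathcomp Require Import ring.
Import GRing.Theory.
Local Open Scope ring_scope.

(** Write [u = P 1] and [x_k = P^k(1)]. The Baxter identity applied to [1] and
[x_(k-1)] gives, by induction on [k], the relation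
[u x_k = (k+1) x_(k+1) + k lambda x_k]. So [k! x_k] satisfies the recurrence
[y_(k+1) = (u - k lambda) y_k] of the homogenised falling factorials, and both
formulas follow from the triangular recurrences of the Stirling numbers. *)

(** Serves triangular recurrences: when the entry at [k] in row [n.+1] combines entries [k-1] and
    [k] of row [n], the sum over the new row becomes one over the old row. The hypotheses kill the
    two boundary terms. *)
Lemma big_ord_shiftD (V : nmodType) n (f g : nat -> V) :
    f 0%N = 0 -> g n.+1 = 0 ->
  \sum_(k < n.+2) (f k + g k) = \sum_(k < n.+1) (f k.+1 + g k).
Proof.
move=> f0 gn; rewrite !big_split /=; congr (_ + _).
  by rewrite big_ord_recl f0 add0r.
by rewrite big_ord_recr /= gn addr0.
Qed.

Lemma ffact_polyS n : ffact_poly n.+1 = ffact_poly n * ('X - n%:R%:P).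
Proof. by rewrite /ffact_poly big_ord_recr. Qed.

Lemma stirling1_small n k : (n < k)%N -> stirling1 n k = 0.
Proof. by move=> ltnk; rewrite /stirling1 nth_default ?size_tuple. Qed.

Lemma stirling2_small n k : (n < k)%N -> stirling2 n k = 0.
Proof. by move=> ltnk; rewrite /stirling2 nth_default ?size_tuple. Qed.

Lemma stirling1_00 : stirling1 0 0 = 1.
Proof.
symmetry; apply: (@stirling1_uniq 0 (fun=> 1)) => //.
by rewrite big_ord1 /ffact_poly big_ord0 scale1r expr0.
Qed.

Lemma stirling2_00 : stirling2 0 0 = 1.
Proof.
symmetry; apply: (@stirling2_uniq 0 (fun=> 1)) => //.
by rewrite big_ord1 /ffact_poly big_ord0 scale1r expr0.
Qed.

(** Compares coefficients in [(t)_(n+1) = (t)_n (t - n)], by uniqueness of the expansion in powers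
    of [t]. *)
Lemma stirling1_rec n k : (k <= n.+1)%N ->
  stirling1 n.+1 k = (if k is j.+1 then stirling1 n j else 0)
                     - n%:R * stirling1 n k.
Proof.
move=> lekn; symmetry; move: k lekn.
apply: (@stirling1_uniq _ (fun k => (if k is j.+1 then stirling1 n j else 0)
                                    - n%:R * stirling1 n k)).
under eq_bigr do rewrite rmorphB scalerBl.
rewrite (@big_ord_shiftD _ n
  (fun k => (if k is j.+1 then stirling1 n j else 0)%:~R *: 'X^k)
  (fun k => - ((n%:R * stirling1 n k)%:~R *: 'X^k))).
- rewrite ffact_polyS stirling1P mulr_suml; apply: eq_bigr => k _.
  rewrite rmorphM /= rmorph_nat exprSr -!mul_polyC polyCM; ring.
- by rewrite scale0r.
- by rewrite stirling1_small // mulr0 scale0r oppr0.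
Qed.

(** Expands [t^n t] using [t (t)_k = (t)_(k+1) + k (t)_k], then applies uniqueness in the basis of
    falling factorials. *)
Lemma stirling2_rec n k : (k <= n.+1)%N ->
  stirling2 n.+1 k = (if k is j.+1 then stirling2 n j else 0)
                     + k%:R * stirling2 n k.
Proof.
move=> lekn; symmetry; move: k lekn.
apply: (@stirling2_uniq _ (fun k => (if k is j.+1 then stirling2 n j else 0)
                                    + k%:R * stirling2 n k)).
under eq_bigr do rewrite rmorphD scalerDl.
rewrite (@big_ord_shiftD _ n
  (fun k => (if k is j.+1 then stirling2 n j else 0)%:~R *: ffact_poly k)
  (fun k => (k%:R * stirling2 n k)%:~R *: ffact_poly k)).
- rewrite exprSr stirling2P mulr_suml; apply: eq_bigr => k _.
  rewrite ffact_polyS rmorphM /= rmorph_nat -!mul_polyC polyCM; ring.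
- by rewrite scale0r.
- by rewrite stirling2_small // mulr0 scale0r.
Qed.

Lemma stirling1_Sn0 n : stirling1 n.+1 0 = 0.
Proof.
by elim: n => [|n IHn]; rewrite stirling1_rec // ?IHn ?mulr0 ?mul0r subr0.
Qed.

Lemma stirling2_Sn0 n : stirling2 n.+1 0 = 0.
Proof. by rewrite stirling2_rec // mul0r addr0. Qed.

Section Baxter.

Variables (C : comPzRingType) (lambda : C) (R : pzAlgType C).
Variable P : {linear R -> R}.
Hypothesis hP : baxter lambda P.

Lemma baxter_mul_iter k :
  P 1 * iter k P 1 = iter k.+1 P 1 *+ k.+1 + (k%:R * lambda) *: iter k P 1.
Proof.
elim: k => [|k IHk]; first by rewrite mulr1 mul0r scale0r addr0.
(* The Baxter identity gives one copy of [P^(k+2)(1)] and [lambda] times [P^(k+1)(1)]; [IHk] under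
   [P] adds [k+1] copies of the former and [k lambda] times the latter. *)
rewrite [iter k.+1 P 1]iterS hP !mul1r IHk linearD linearMn linearZ /=.
rewrite addrA -mulrS -addrA -scalerDl; congr (_ + _ *: _).
by rewrite -[X in _ + X]mul1r -mulrDl natr1.
Qed.

Lemma baxter_expr_sum n : P 1 ^+ n =
  \sum_(k < n.+1) (k`!%:R * (stirling2 n k)%:~R * lambda ^+ (n - k))
    *: iter k P 1.
Proof.
elim: n => [|n IHn].
  by rewrite big_ord1 stirling2_00 fact0 !mulr1 scale1r.
(* [s k] is [S(n, k-1)], set to 0 at [k = 0] so that the shifted family has no first term. *)
pose s j := if j is i.+1 then stirling2 n i else 0.
under eq_bigr => k _ do
  rewrite stirling2_rec -1?ltnS // rmorphD mulrDr mulrDl scalerDl.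
rewrite (@big_ord_shiftD _ n
  (fun k => (k`!%:R * (s k)%:~R * lambda ^+ (n.+1 - k)) *: iter k P 1)
  (fun k => (k`!%:R * (k%:R * stirling2 n k)%:~R * lambda ^+ (n.+1 - k))
              *: iter k P 1)).
- rewrite exprS {1}IHn mulr_sumr; apply: eq_bigr => k _.
  rewrite -pzscalerAr baxter_mul_iter scalerDr scalerA -scaler_nat scalerA.
  (* As [k <= n], truncated subtraction is exact and the unshifted term gains one factor
     [lambda]. *)
  rewrite subSS subSn -1?ltnS // exprS factS natrM rmorphM /= rmorph_nat.
  by congr (_ *: _ + _ *: _); ring.
- by rewrite mulr0 mul0r scale0r.
- by rewrite stirling2_small // !mulr0 mul0r scale0r.
Qed.

Lemma baxter_iter_sum n : iter n P 1 *+ n`! =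
  \sum_(k < n.+1) ((stirling1 n k)%:~R * lambda ^+ (n - k)) *: P 1 ^+ k.
Proof.
elim: n => [|n IHn].
  by rewrite big_ord1 stirling1_00 mulr1 scale1r.
pose s j := if j is i.+1 then stirling1 n i else 0.
under eq_bigr => k _ do
  rewrite stirling1_rec -1?ltnS // rmorphB mulrBl scalerBl.
rewrite (@big_ord_shiftD _ n
  (fun k => ((s k)%:~R * lambda ^+ (n.+1 - k)) *: P 1 ^+ k)
  (fun k => - (((n%:R * stirling1 n k)%:~R * lambda ^+ (n.+1 - k))
                 *: P 1 ^+ k))).
(* With [y_n = n! P^n(1)], this is [y_(n+1) = (u - n lambda) y_n]: the [lambda] term of
   [baxter_mul_iter] cancels. *)
- have -> : iter n.+1 P 1 *+ n.+1`! =
      P 1 * (iter n P 1 *+ n`!) - (n%:R * lambda) *: (iter n P 1 *+ n`!).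
    rewrite mulrnAr baxter_mul_iter mulrnDl scalerMnr.
    by rewrite addrK -mulrnA -factS.
  rewrite IHn mulr_sumr scaler_sumr -sumrB; apply: eq_bigr => k _.
  rewrite -pzscalerAr -exprS scalerA subSS subSn -1?ltnS //.
  rewrite [lambda ^+ _.+1]exprS rmorphM /= rmorph_nat.
  by congr (_ - _ *: _); ring.
- by rewrite mul0r scale0r.
- by rewrite stirling1_small // mulr0 mul0r scale0r oppr0.
Qed.

End Baxter.

Theorem theorem2p1 (C : comPzRingType) (lambda : C) (R : pzAlgType C)
    (P : {linear R -> R}) (hP : baxter lambda P) (n : nat) (hn : (1 <= n)%N) :
  P 1 ^+ n =
    \sum_(1 <= k < n.+1)
      (k`!%:R * (stirling2 n k)%:~R * lambda ^+ (n - k)) *: iter k P 1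
  /\
  iter n P 1 *+ n`! =
    \sum_(1 <= k < n.+1)
      ((stirling1 n k)%:~R * lambda ^+ (n - k)) *: P 1 ^+ k.
Proof.
(* The sums proved above start at [k = 0]; for a positive row index that term vanishes, since
   [s(n,0) = S(n,0) = 0]. *)
case: n hn => // n _; rewrite (baxter_expr_sum _ _ _ _ hP).
rewrite (baxter_iter_sum _ _ _ _ hP) !big_add1 !big_mkord !(big_ord_recl n.+1) /=.
by rewrite stirling1_Sn0 stirling2_Sn0 mulr0 !mul0r !scale0r !add0r.
Qed.
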